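(* Let $n$ be a positive integer. Then $$K(n) \equiv (-1)^{n-1} S(n-1) \pmod{n}.$$
   Context: Kurepa's left factorial function is defined by $K(0)=0$ and $K(n)=\sum_{k=0}^{n-1} k!$ for $n\ge 1$. The subfactorial function is defined by $S(n)=n!\,\sum_{k=0}^{n}\frac{(-1)^k}{k!}$ for integers $n\ge 0$ (an integer, with $S(0)=1$, $S(1)=0$). *)

(* Defs.v *)
From mathcomp Require Import all_boot all_order all_algebra.

Set Implicit Arguments.
Unset Strict Implicit.
Unset Printing Implicit Defensive.

Import GRing.Theory Num.Theory.
Local Open Scope ring_scope.

Definition kurepa (n : nat) : nat := (\sum_(k < n) k`!)%N.

Definition subfactorial_rat (n : nat) : rat :=
  n`!%:R * \sum_(k < n.+1) (-1) ^+ k / k`!%:R.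

Lemma subfactorial_rat_int (n : nat) : subfactorial_rat n \is a Num.int.
Proof.
rewrite /subfactorial_rat mulr_sumr rpred_sum // => k _.
have nz : (k`!%:R : rat) != 0 by rewrite pnatr_eq0 -lt0n fact_gt0.
have kn : (k <= n)%N by rewrite -ltnS.
rewrite -(bin_fact kn) mulnCA natrM mulrC -mulrA mulKf //.
by rewrite rpredM ?rpred_nat ?rpredX ?rpredN ?rpred1.
Qed.

(* Since the defining expression is an integer, taking its numerator only
   changes the type: see [subfactorialE]. *)
Definition subfactorial (n : nat) : int := numq (subfactorial_rat n).

Lemma subfactorialE (n : nat) : (subfactorial n)%:~R = subfactorial_rat n.
Proof.
have /intrP[m Em] := subfactorial_rat_int n.
by rewrite /subfactorial Em numq_int.
Qed.

(* Main.v *)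
Require Import Defs.
From mathcomp Require Import all_boot all_order all_algebra ring.

(* Write [n = m + 1]. Multiplying out,
   [(-1)^m S(m) = \sum_(j <= m) (-1)^j m (m - 1) ... (m - j + 1)], and since
   [m = -1] modulo [n], the [j]-th term is congruent to [j!]. *)

Import GRing.Theory Num.Theory.
Local Open Scope ring_scope.

(** Both sides become sums over [j <= m] that agree term by term modulo [m.+1]: [subfactorial_ffact]
    gives the signed falling factorials, [dvdz_fact_sub_ffact] compares each with [j!]. *)

Lemma subfactorial_ffact (m : nat) :
  (-1) ^+ m * subfactorial m = \sum_(j < m.+1) (-1) ^+ j * (m ^_ j)%:Z.
Proof.
apply: (@intr_inj rat).
rewrite rmorphM rmorphXn rmorphN1 /= subfactorialE /subfactorial_rat !mulr_sumr.
(* Reversing the sum by [k = m - j] turns [m! / k!] into [m ^_ j]. *)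
rewrite rmorph_sum (reindex_inj rev_ord_inj) /=; apply: eq_bigr => j _.
have le_jm : (j <= m)%N by rewrite -ltnS.
have nz : ((m - j)`!%:R : rat) != 0 by rewrite pnatr_eq0 -lt0n fact_gt0.
rewrite subSS rmorphM rmorphXn rmorphN1 -(ffact_fact le_jm) natrM.
have -> : (-1) ^+ m = (-1) ^+ j * (-1) ^+ (m - j) :> rat.
  by rewrite -exprD subnKC.
have sqr_sign : (-1) ^+ (m - j) * (-1) ^+ (m - j) = 1 :> rat.
  by rewrite -expr2 sqrr_sign.
rewrite [LHS](_ : _ = (-1) ^+ j * (m ^_ j)%:R *
  ((-1) ^+ (m - j) * (-1) ^+ (m - j))); last by field.
by rewrite sqr_sign mulr1.
Qed.

(** Modulo [m.+1], the factors [m, m - 1, ..., m - j + 1] are [-1, -2, ..., -j]. *)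
Lemma dvdz_fact_sub_ffact (m j : nat) : (j <= m)%N ->
  (m.+1 %| j`!%:Z - (-1) ^+ j * (m ^_ j)%:Z)%Z.
Proof.
elim: j => [|j IHj] lt_jm; first by rewrite fact0 ffactn0 mul1r subrr dvdz0.
have mjE : (m - j)%N%:Z = m%:Z - j%:Z by rewrite -subzn // ltnW.
(* The new factors satisfy [j + 1 = (m + 1) - (m - j)], which leaves a multiple of [m.+1] and a
   multiple of the previous difference. *)
have -> : (j.+1)`!%:Z - (-1) ^+ j.+1 * (m ^_ j.+1)%:Z =
    m.+1%:Z * j`!%:Z
    - (j`!%:Z - (-1) ^+ j * (m ^_ j)%:Z) * (m%:Z - j%:Z).
  by rewrite factS ffactnSr !PoszM mjE !intS exprS; ring.
by rewrite rpredB ?dvdz_mulr // IHj // ltnW.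
Qed.

Theorem lemma2p1 (n : nat) (n_gt0 : (0 < n)%N) :
  ((kurepa n)%:Z = (-1) ^+ (n - 1)%N * subfactorial (n - 1)%N %[mod n%:Z])%Z.
Proof.
case: n n_gt0 => // m _; rewrite subn1 /= subfactorial_ffact.
apply/eqP; rewrite eqz_mod_dvd /kurepa -[Posz _]natz natr_sum -sumrB.
by apply: rpred_sum => j _; rewrite natz dvdz_fact_sub_ffact // -ltnS.
Qed.
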